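(* (i) $(\mathbb R^\infty,\bar+)$ and $(\mathbb R^\infty,\hat+)$ are hyper groups, with identity set $\{0_n\in\mathbb R^n: n\ge1\}$ indexed by the positive integers ordered by divisibility. (ii) $(\mathcal M_1,\bar+)$ and $(\mathcal M_1,\hat+)$ are hyper groups, with identity set $\{0_{n\times n}: n\ge1\}$ indexed by the positive integers ordered by divisibility. (iii) For each positive rational $\mu=\mu_y/\mu_x$ with $\gcd(\mu_y,\mu_x)=1$, $(\mathcal M_\mu,\bar+)$ and $(\mathcal M_\mu,\hat+)$ are hyper groups, with identity set $\{0_{n\mu_y\times n\mu_x}: n\ge1\}$ indexed by the positive integers $n$ ordered by divisibility. (iv) $(\mathcal M,\hat+)$ is a hyper group, with identity set $\{0_{m\times n}: m,n\ge1\}$ indexed by the pairs $(m,n)$ of positive integers ordered by componentwise divisibility.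
   Context: $\mathbb R^\infty=\bigcup_{n\ge1}\mathbb R^n$, $\mathcal M_{m\times n}$ is the set of real $m\times n$ matrices, $\mathcal M=\bigcup_{m,n\ge1}\mathcal M_{m\times n}$ (disjoint unions), $\mathcal M_\mu=\{A\in\mathcal M_{m\times n}: m/n=\mu\}$, so $\mathcal M_1$ is the set of all square matrices; elements of $\mathcal M_\mu$ have size $m\mu_y\times m\mu_x$ for a unique $m\ge1$. $\otimes$ is the Kronecker product; $\mathbf 1_n=(1,\dots,1)^T\in\mathbb R^n$, $E_n=\frac1{\sqrt n}\mathbf 1_n$, $E_{m\times n}=E_mE_n^T$, $J_n=\frac1n\mathbf 1_n\mathbf 1_n^T$. Additions: for $x\in\mathbb R^m,y\in\mathbb R^n,t=\mathrm{lcm}(m,n)$: $x\bar+y=x\otimes\mathbf 1_{t/m}+y\otimes\mathbf 1_{t/n}$ and $x\hat+y=x\otimes E_{t/m}+y\otimes E_{t/n}$. On $\mathcal M_\mu$ (including $\mu=1$), for $A\in\mathcal M_{m\mu_y\times m\mu_x},B\in\mathcal M_{n\mu_y\times n\mu_x},t=\mathrm{lcm}(m,n)$: $A\bar+B=A\otimes I_{t/m}+B\otimes I_{t/n}$ and $A\hat+B=A\otimes J_{t/m}+B\otimes J_{t/n}$. On $\mathcal M$, for $A\in\mathcal M_{m\times n},B\in\mathcal M_{p\times q},s=\mathrm{lcm}(m,p),t=\mathrm{lcm}(n,q)$: $A\hat+B=A\otimes E_{s/m\times t/n}+B\otimes E_{s/p\times t/q}$. Hyper group: Let $(G,* )$ be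 a semigroup. A subset $\mathbf e\subset G$ is an identity set if (i) $g*e=e*g$ for all $g\in G$, $e\in\mathbf e$; (ii) $\mathbf e=\{e_\lambda:\lambda\in\Lambda\}$ is indexed without repetition by a lattice $(\Lambda,\le)$ and $e_\lambda*e_\mu=e_{\lambda\vee\mu}$; (iii) for each $g\in G$ there is a unique $e_g=e_{\lambda_g}\in\mathbf e$ such that for all $\lambda\in\Lambda$: $e_\lambda*g=g$ if and only if $\lambda\le\lambda_g$. A hyper group $(G,*,\mathbf e)$ is a semigroup with an identity set such that for each $g\in G$ there is $g^{-1}\in G$ with $g*g^{-1}=g^{-1}*g=e_g$. *)

(* Defs.v *)
From HB Require Import structures.
From mathcomp Require Import all_boot all_order all_algebra.
From mathcomp Require Import reals mxtens.

Set Implicit Arguments.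
Unset Strict Implicit.
Unset Printing Implicit Defensive.

Import Order.TTheory GRing.Theory Num.Theory.
Local Open Scope ring_scope.

(* The identity set is the range of the family e; injectivity of e is the
   "indexed without repetition" requirement. *)
Section HyperGroup.
Variables (G : Type) (op : G -> G -> G).
Variables (d : Order.disp_t) (L : latticeType d) (e : L -> G).

Definition is_identity_index (g : G) (lg : L) : Prop :=
  forall l : L, op (e l) g = g <-> (l <= lg)%O.

Record identity_set : Prop := IdentitySet {
  idset_comm : forall (g : G) (l : L), op g (e l) = op (e l) g;
  idset_inj : injective e;
  idset_join : forall l m : L, op (e l) (e m) = e (l `|` m)%O;
  idset_index : forall g : G, exists! lg : L, is_identity_index g lg
}.

Record hyper_group : Prop := HyperGroup {
  hyper_assoc : associative op;
  hyper_idset : identity_set;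
  hyper_inv : forall g : G, exists (g' : G) (lg : L),
    [/\ is_identity_index g lg, op g g' = e lg & op g' g = e lg]
}.

End HyperGroup.

(* The lattice of positive integers under divisibility: join is lcm, meet is
   gcd (inherited from natdvd, which contains 0 and is therefore cut down). *)
Definition posdvd_pred : pred natdvd := fun n => (0 < (n : nat))%N.

Record posdvd := PosDvd {
  posdvd_val : natdvd;
  posdvd_gt0 : posdvd_pred posdvd_val
}.

HB.instance Definition _ := [isSub for posdvd_val].
HB.instance Definition _ := [Choice of posdvd by <:].

Lemma posdvd_meet_closed : meet_closed posdvd_pred.
Proof.
by move=> m n; rewrite !unfold_in => m0 _; rewrite /posdvd_pred gcdn_gt0 m0.
Qed.

Lemma posdvd_join_closed : join_closed posdvd_pred.
Proof.
by move=> m n; rewrite !unfold_in => m0 n0; rewrite /posdvd_pred lcmn_gt0 m0.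
Qed.

HB.instance Definition _ :=
  Order.SubChoice_isSubLattice.Build Order.dvd_display natdvd posdvd_pred
    Order.dvd_display posdvd posdvd_meet_closed posdvd_join_closed.

Coercion posdvd_nat (n : posdvd) : nat := posdvd_val n.

Lemma posdvd_leE (m n : posdvd) : (m <= n)%O = (m %| n)%N.
Proof. by []. Qed.

Lemma posdvd_joinE (m n : posdvd) : ((m `|` n)%O : nat) = lcmn m n.
Proof. by []. Qed.

Lemma posdvd2_leE (p q : posdvd *p posdvd) :
  (p <= q)%O = (p.1 %| q.1)%N && (p.2 %| q.2)%N.
Proof. by []. Qed.

Section Special.
Variable R : realType.

Definition ones (n : nat) : 'cV[R]_n := const_mx 1.
Definition Ecol (n : nat) : 'cV[R]_n := (Num.sqrt n%:R)^-1 *: ones n.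
Definition Emx (m n : nat) : 'M[R]_(m, n) := Ecol m *m (Ecol n)^T.
Definition Jmx (n : nat) : 'M[R]_n := n%:R^-1 *: (ones n *m (ones n)^T).

End Special.

Lemma mul_lcmn_divl m n : (m * (lcmn m n %/ m) = lcmn m n)%N.
Proof. by rewrite mulnC divnK // dvdn_lcml. Qed.

Lemma mul_lcmn_divr m n : (n * (lcmn m n %/ n) = lcmn m n)%N.
Proof. by rewrite mulnC divnK // dvdn_lcmr. Qed.

Section Vectors.
Variable R : realType.

Record rinf := RInf {
  vdim : nat;
  vdim_gt0 : (0 < vdim)%N;
  vval : 'cV[R]_vdim
}.

Lemma vdim_lcmn_gt0 (x y : rinf) : (0 < lcmn (vdim x) (vdim y))%N.
Proof. by rewrite lcmn_gt0 !vdim_gt0. Qed.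

(* The two casts are along m * (t / m) = t and n * (t / n) = t; the width
   1 * 1 of the Kronecker product of two columns reduces to 1. *)
Definition vbar (x y : rinf) : rinf :=
  let t := lcmn (vdim x) (vdim y) in
  RInf (vdim_lcmn_gt0 x y)
    (castmx (mul_lcmn_divl _ _, erefl) (vval x *t ones R (t %/ vdim x)) +
     castmx (mul_lcmn_divr _ _, erefl) (vval y *t ones R (t %/ vdim y))).

Definition vhat (x y : rinf) : rinf :=
  let t := lcmn (vdim x) (vdim y) in
  RInf (vdim_lcmn_gt0 x y)
    (castmx (mul_lcmn_divl _ _, erefl) (vval x *t Ecol R (t %/ vdim x)) +
     castmx (mul_lcmn_divr _ _, erefl) (vval y *t Ecol R (t %/ vdim y))).

Definition vzero (n : posdvd) : rinf := @RInf n (posdvd_gt0 n) 0.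

End Vectors.

Section Matrices.
Variable R : realType.

Record minf := MInf {
  nrows : nat;
  ncols : nat;
  nrows_gt0 : (0 < nrows)%N;
  ncols_gt0 : (0 < ncols)%N;
  mval : 'M[R]_(nrows, ncols)
}.

Lemma nrows_lcmn_gt0 (A B : minf) : (0 < lcmn (nrows A) (nrows B))%N.
Proof. by rewrite lcmn_gt0 !nrows_gt0. Qed.

Lemma ncols_lcmn_gt0 (A B : minf) : (0 < lcmn (ncols A) (ncols B))%N.
Proof. by rewrite lcmn_gt0 !ncols_gt0. Qed.

Definition mhat (A B : minf) : minf :=
  let s := lcmn (nrows A) (nrows B) in
  let t := lcmn (ncols A) (ncols B) in
  MInf (nrows_lcmn_gt0 A B) (ncols_lcmn_gt0 A B)
    (castmx (mul_lcmn_divl _ _, mul_lcmn_divl _ _)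
       (mval A *t Emx R (s %/ nrows A) (t %/ ncols A)) +
     castmx (mul_lcmn_divr _ _, mul_lcmn_divr _ _)
       (mval B *t Emx R (s %/ nrows B) (t %/ ncols B))).

Definition mzero (p : posdvd *p posdvd) : minf :=
  @MInf p.1 p.2 (posdvd_gt0 p.1) (posdvd_gt0 p.2) 0.

End Matrices.

Section RatioMatrices.
Variables (R : realType) (mu : rat).

Definition has_ratio (A : minf R) : bool :=
  (nrows A)%:Q / (ncols A)%:Q == mu.

Record mratio := MRatio {
  mratio_val :> minf R;
  mratio_ratio : has_ratio mratio_val
}.

(* mu = mu_y / mu_x in lowest terms (for mu > 0) *)
Definition mu_y : nat := `|numq mu|%N.
Definition mu_x : nat := `|denq mu|%N.

(* The m such that A has size m mu_y x m mu_x; see nrows_level, ncols_level. *)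
Definition level (A : mratio) : nat := (nrows A %/ mu_y)%N.

Lemma mratio_gt0 (A : mratio) : 0 < mu.
Proof.
case: A => A /= /eqP <-.
by rewrite divr_gt0 // ltr0z ltz_nat ?nrows_gt0 ?ncols_gt0.
Qed.

Lemma mu_x_gt0 : (0 < mu_x)%N.
Proof. by rewrite /mu_x absz_gt0 denq_neq0. Qed.

Lemma mu_y_gt0 : 0 < mu -> (0 < mu_y)%N.
Proof. by move=> mu0; rewrite /mu_y absz_gt0 numq_eq0 gt_eqF. Qed.

Lemma mu_yxE : 0 < mu -> mu = mu_y%:Q / mu_x%:Q.
Proof.
move=> mu0; rewrite /mu_y /mu_x !gez0_abs ?denq_ge0 ?divq_num_den //.
by rewrite numq_ge0 ltW.
Qed.

Lemma mratio_cross (A : mratio) :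
  (nrows A * mu_x = mu_y * ncols A)%N.
Proof.
have mu0 := mratio_gt0 A; case: A => A /= /eqP.
rewrite {1}(mu_yxE mu0) => /eqP.
rewrite eqr_div ?intr_eq0 ?eqz_nat -?lt0n ?ncols_gt0 ?mu_x_gt0 //.
by rewrite -!intrM eqr_int -!PoszM eqz_nat => /eqP ->.
Qed.

Lemma nrows_level (A : mratio) : nrows A = (level A * mu_y)%N.
Proof.
rewrite /level divnK //; have: (mu_y %| nrows A * mu_x)%N.
  by rewrite mratio_cross dvdn_mulr.
by rewrite Gauss_dvdl // /mu_y /mu_x coprime_num_den.
Qed.

Lemma ncols_level (A : mratio) : ncols A = (level A * mu_x)%N.
Proof.
have y0 := mu_y_gt0 (mratio_gt0 A).
apply/eqP; rewrite -(eqn_pmul2l y0) -mratio_cross nrows_level.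
by rewrite -mulnA mulnCA.
Qed.

Lemma level_gt0 (A : mratio) : (0 < level A)%N.
Proof. by have := nrows_gt0 A; rewrite nrows_level muln_gt0 => /andP[]. Qed.

Lemma level_lcmn_rows_gt0 (A B : mratio) :
  (0 < lcmn (level A) (level B) * mu_y)%N.
Proof.
by rewrite muln_gt0 lcmn_gt0 !level_gt0 (mu_y_gt0 (mratio_gt0 A)).
Qed.

Lemma level_lcmn_cols_gt0 (A B : mratio) :
  (0 < lcmn (level A) (level B) * mu_x)%N.
Proof. by rewrite muln_gt0 lcmn_gt0 !level_gt0 mu_x_gt0. Qed.

Lemma scaled_ratio (n : nat) : 0 < mu -> (0 < n)%N ->
  (n * mu_y)%N%:Q / (n * mu_x)%N%:Q = mu.
Proof.
move=> mu0 n0; rewrite [RHS](mu_yxE mu0) !PoszM !intrM -mulf_div divff ?mul1r //.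
by rewrite intr_eq0 eqz_nat -lt0n.
Qed.

Lemma level_rows_l (A B : mratio) :
  (nrows A * (lcmn (level A) (level B) %/ level A) =
   lcmn (level A) (level B) * mu_y)%N.
Proof. by rewrite nrows_level mulnAC mul_lcmn_divl. Qed.

Lemma level_cols_l (A B : mratio) :
  (ncols A * (lcmn (level A) (level B) %/ level A) =
   lcmn (level A) (level B) * mu_x)%N.
Proof. by rewrite ncols_level mulnAC mul_lcmn_divl. Qed.

Lemma level_rows_r (A B : mratio) :
  (nrows B * (lcmn (level A) (level B) %/ level B) =
   lcmn (level A) (level B) * mu_y)%N.
Proof. by rewrite nrows_level mulnAC mul_lcmn_divr. Qed.

Lemma level_cols_r (A B : mratio) :
  (ncols B * (lcmn (level A) (level B) %/ level B) =
   lcmn (level A) (level B) * mu_x)%N.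
Proof. by rewrite ncols_level mulnAC mul_lcmn_divr. Qed.

Definition level_mx (A B : mratio)
    (C : 'M[R]_(lcmn (level A) (level B) * mu_y,
                lcmn (level A) (level B) * mu_x)) : minf R :=
  MInf (level_lcmn_rows_gt0 A B) (level_lcmn_cols_gt0 A B) C.

Lemma level_mx_ratio (A B : mratio) C : has_ratio (@level_mx A B C).
Proof.
apply/eqP; apply: scaled_ratio; first exact: mratio_gt0 A.
by rewrite lcmn_gt0 !level_gt0.
Qed.

Definition mbar_ratio (A B : mratio) : mratio :=
  let t := lcmn (level A) (level B) in
  MRatio (level_mx_ratio
    (castmx (level_rows_l A B, level_cols_l A B)
       (mval A *t (1%:M : 'M[R]_(t %/ level A))) +
     castmx (level_rows_r A B, level_cols_r A B)
       (mval B *t (1%:M : 'M[R]_(t %/ level B))))).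

Definition mhat_ratio (A B : mratio) : mratio :=
  let t := lcmn (level A) (level B) in
  MRatio (level_mx_ratio
    (castmx (level_rows_l A B, level_cols_l A B)
       (mval A *t Jmx R (t %/ level A)) +
     castmx (level_rows_r A B, level_cols_r A B)
       (mval B *t Jmx R (t %/ level B)))).

Section Zero.
Hypothesis mu0 : 0 < mu.

Lemma zero_rows_gt0 (n : posdvd) : (0 < n * mu_y)%N.
Proof. by rewrite muln_gt0 (mu_y_gt0 mu0) andbT; exact: posdvd_gt0. Qed.

Lemma zero_cols_gt0 (n : posdvd) : (0 < n * mu_x)%N.
Proof. by rewrite muln_gt0 mu_x_gt0 andbT; exact: posdvd_gt0. Qed.

Lemma zero_ratio (n : posdvd) :
  has_ratio (MInf (zero_rows_gt0 n) (zero_cols_gt0 n) 0).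
Proof. by apply/eqP; apply: scaled_ratio => //; exact: posdvd_gt0. Qed.

Definition mzero_ratio (n : posdvd) : mratio := MRatio (zero_ratio n).

End Zero.
End RatioMatrices.

Lemma mzero_square_ratio (R : realType) (n : posdvd) :
  has_ratio 1 (mzero R (n, n)).
Proof.
rewrite /has_ratio /= divff // intr_eq0 eqz_nat -lt0n.
exact: posdvd_gt0.
Qed.

Definition mzero_square (R : realType) (n : posdvd) : mratio R 1 :=
  MRatio (mzero_square_ratio R n).

(* Main.v *)
Require Import Defs.
From mathcomp Require Import all_boot all_order all_algebra.
From mathcomp Require Import reals boolp functions mxtens.

Set Implicit Arguments.
Unset Strict Implicit.
Unset Printing Implicit Defensive.

Import Order.TTheory GRing.Theory Num.Theory.

Local Open Scope ring_scope.

(** Each of the seven operations is a Plonka sum (a strong semilattice of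
    abelian groups).  Attach to an element its degree, namely its size
    (for a fixed ratio, the common factor of its two dimensions): a positive
    integer under divisibility, or a pair of them.  The elements of a
    given degree form an abelian group under entrywise addition.  When l
    divides m, an element of degree l is carried to degree m by the Kronecker
    product with a fixed matrix K (m / l); the sum of two elements is taken
    after carrying both to the join (the lcm) of their degrees.

    The carrying maps are additive.  They are functorial, that is, carrying
    from l to m and then from m to n is carrying from l to n, because the
    kernels satisfy K 1 = 1 and K (a b) = K a (x) K b: this holds for the
    all-ones columns, their normalisations E, the identity matrices, the
    averaging matrices J and the matrices E_{m x n}.

    The theorem follows from additivity and functoriality
    (plonka_hyper_group).  Associativity holds since both bracketings are the
    sum of the three elements carried to the common join.  Adding the zero of
    degree l to g merely carries g to the join of l and deg g, so it fixes g
    exactly when l <= deg g, and deg g is the index of g; the inverse of g is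
    its entrywise opposite.

    Sizes live in the types of matrices, so functoriality would be an equation
    between matrices of different types.  This is avoided by recording a
    matrix as a function of two natural numbers that vanishes outside its size
    (entry).  All sizes then share one abelian group, casts become invisible
    (entry_castmx), and the Kronecker product with B becomes an additive
    operator on functions (blowup, entry_tens, blowup_tens). *)

(** * Plonka sums of abelian groups *)

Section PlonkaSum.
Variables (G : Type) (op : G -> G -> G).
Variables (d : Order.disp_t) (L : latticeType d) (e : L -> G).
Variables (V : zmodType) (deg : G -> L) (coord : G -> V).
Variable lift : L -> L -> V -> V.

(** All groups of the directed system are read inside the single group V
    through coord, which need only be faithful in each degree.  That makes the
    transition maps endomorphisms of V and keeps dependent types out. *)
Lemma plonka_hyper_group :
    (forall g h, deg g = deg h -> coord g = coord h -> g = h) ->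
    (forall l m, {morph lift l m : u v / u + v}) ->
    (forall l v, lift l l v = v) ->
    (forall l m n v, (l <= m)%O -> (m <= n)%O ->
       lift m n (lift l m v) = lift l n v) ->
    (forall g h, deg (op g h) = (deg g `|` deg h)%O) ->
    (forall g h, coord (op g h) =
       lift (deg g) (deg g `|` deg h)%O (coord g) +
       lift (deg h) (deg g `|` deg h)%O (coord h)) ->
    (forall l, deg (e l) = l) -> (forall l, coord (e l) = 0) ->
    (forall g, exists g', deg g' = deg g /\ coord g' = - coord g) ->
  hyper_group op e.
Proof.
move=> coord_inj liftD lift_id lift_comp degM coordM deg_e coord_e negE.
(* In a group an idempotent is zero. *)
have lift0 l m : lift l m 0 = 0.
  by apply: (addrI (lift l m 0)); rewrite -liftD !addr0.
have opC g h : op g h = op h g.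
  by apply: coord_inj; rewrite ?degM ?coordM joinC // addrC.
(* The zero of degree l contributes nothing but its degree. *)
have idx g : is_identity_index op e g (deg g).
  move=> l; split=> [eg | le_lg].
    by rewrite -[in X in (_ <= X)%O]eg degM deg_e leUl.
  have lgE : (l `|` deg g)%O = deg g by apply/join_idPr.
  apply: coord_inj; rewrite ?degM ?coordM ?deg_e ?lgE //.
  by rewrite coord_e lift0 add0r lift_id.
split.
- move=> g h k; apply: coord_inj; first by rewrite !degM joinA.
  rewrite !coordM !degM !liftD -!joinA.
  by rewrite !lift_comp ?addrA ?leUl ?leUr // joinA leUl.
- split=> [g l|l m lm|l m|g]; first exact: opC.
  + by rewrite -(deg_e l) lm deg_e.
  + apply: coord_inj; rewrite ?degM ?coordM !(deg_e, coord_e) //.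
    by rewrite !lift0 addr0.
  + exists (deg g); split=> [|l idl]; first exact: idx.
    by apply/le_anti/andP; split; [apply/idl/idx|apply/idx/idl].
- move=> g; have [g' [dg' cg']] := negE g; exists g', (deg g).
  have opgg' : op g g' = e (deg g).
    apply: coord_inj; rewrite ?degM ?coordM ?deg_e ?coord_e dg' joinxx //.
    by rewrite cg' !lift_id subrr.
  by split; rewrite // opC.
Qed.

End PlonkaSum.

(** * Matrices as functions on pairs of natural numbers *)

Section Entries.
Variable R : pzRingType.
Implicit Types m n p q : nat.

Definition entry m n (A : 'M[R]_(m, n)) (i j : nat) : R :=
  if insub i is Some i' then if insub j is Some j' then A i' j' else 0 else 0.

Lemma entryE m n (A : 'M[R]_(m, n)) (i : 'I_m) (j : 'I_n) : entry A i j = A i j.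
Proof. by rewrite /entry !valK. Qed.

Lemma entry_out m n (A : 'M[R]_(m, n)) i j :
  ~~ ((i < m)%N && (j < n)%N) -> entry A i j = 0.
Proof.
by rewrite /entry; case: insubP => // i' -> _; case: insubP => // j' ->.
Qed.

Lemma entry_inj m n : injective (@entry m n).
Proof. by move=> A B AB; apply/matrixP=> i j; rewrite -!entryE AB. Qed.

Lemma entry0 m n : entry (0 : 'M[R]_(m, n)) = 0.
Proof.
apply/funext=> i; apply/funext=> j; rewrite /entry.
by case: insubP => // i' _ _; case: insubP => // j' _ _; rewrite mxE.
Qed.

Lemma entryD m n : {morph @entry m n : A B / A + B}.
Proof.
move=> A B; apply/funext=> i; apply/funext=> j; rewrite /entry /= !addrfctE.
case: insubP => [i' _ _|_]; last by rewrite addr0.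
by case: insubP => [j' _ _|_]; rewrite ?mxE ?addr0.
Qed.

Lemma entryN m n (A : 'M[R]_(m, n)) : entry (- A) = - entry A.
Proof. by apply/eqP; rewrite -addr_eq0 -entryD addNr entry0. Qed.

Lemma entry_castmx m n p q (eqmn : (m = p) * (n = q)) (A : 'M[R]_(m, n)) :
  entry (castmx eqmn A) = entry A.
Proof. by case: eqmn => eqm eqn; case: _ / eqm; case: _ / eqn. Qed.

(** The Kronecker product with B on the right, seen on entries: quotients
    index the left factor and remainders index B. *)
Definition blowup p q (B : 'M[R]_(p, q)) (f : nat -> nat -> R) :
    nat -> nat -> R :=
  fun i j => f (i %/ p)%N (j %/ q)%N * entry B (i %% p)%N (j %% q)%N.

Lemma blowupD p q (B : 'M[R]_(p, q)) : {morph blowup B : f g / f + g}.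
Proof.
move=> f g; apply/funext=> i; apply/funext=> j.
by rewrite /blowup !addrfctE mulrDl.
Qed.

Lemma entry_tens m n p q (A : 'M[R]_(m, n)) (B : 'M[R]_(p, q)) :
  (0 < p)%N -> (0 < q)%N -> entry (A *t B) = blowup B (entry A).
Proof.
move=> p0 q0; apply/funext=> i; apply/funext=> j; rewrite /blowup.
case: (ltnP i (m * p)) => [ilt|ige]; last first.
  rewrite (entry_out (A *t B)) ?(entry_out (A)) ?mul0r //.
    by rewrite ltnNge leq_divRL ?ige.
  by rewrite ltnNge ige.
case: (ltnP j (n * q)) => [jlt|jge]; last first.
  rewrite (entry_out (A *t B)) ?(entry_out (A)) ?mul0r //.
    by rewrite andbC ltnNge leq_divRL ?jge.
  by rewrite andbC ltnNge jge.
by rewrite (entryE _ (Ordinal ilt) (Ordinal jlt)) mxE -!entryE.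
Qed.

(** Associativity of the Kronecker product, which makes carrying between
    degrees functorial; it amounts to reading an index in mixed radix. *)
Lemma blowup_tens m n p q (A : 'M[R]_(m, n)) (B : 'M[R]_(p, q)) f :
  (0 < p)%N -> (0 < q)%N -> blowup (A *t B) f = blowup B (blowup A f).
Proof.
move=> p0 q0; apply/funext=> i; apply/funext=> j; rewrite {1}/blowup.
rewrite entry_tens // /blowup -!modn_divl -!divnMA -!mulrA.
by rewrite (mulnC p) (mulnC q) !modn_dvdm ?dvdn_mull.
Qed.

Lemma blowup1 (B : 'M[R]_1) f : B = 1 -> blowup B f = f.
Proof.
move=> ->; apply/funext=> i; apply/funext=> j.
by rewrite /blowup !divn1 !modn1 (entryE _ ord0 ord0) mxE mulr1.
Qed.

Lemma tens_const_mx m n p q (a b : R) :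
  const_mx a *t const_mx b = const_mx (a * b) :> 'M[R]_(m * p, n * q).
Proof. by apply/matrixP=> i j; rewrite !mxE. Qed.

(** Pairs of indices are equal when both components are, and the numbering
    of pairs by the index set of the product is injective. *)
Lemma id_tens m n : 1%:M = 1%:M *t 1%:M :> 'M[R]_(m * n).
Proof.
apply/matrixP=> i j; case: (mxtens_indexP i) => i1 i2.
case: (mxtens_indexP j) => j1 j2.
rewrite tensmxE !mxE -natrM mulnb (can_eq (@mxtens_indexK m n)).
by rewrite -pair_eqE.
Qed.

End Entries.

(** * Carrying along divisibility *)

Lemma posdvd_nat_gt0 (n : posdvd) : (0 < n)%N.
Proof. exact: posdvd_gt0. Qed.

Lemma divn_posdvd_gt0 (m n : posdvd) : (m <= n)%O -> (0 < n %/ m)%N.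
Proof.
rewrite posdvd_leE divn_gt0 ?posdvd_nat_gt0 //.
exact/dvdn_leq/posdvd_nat_gt0.
Qed.

Lemma muln_posdvd_steps (l m n : posdvd) :
  (l <= m)%O -> (m <= n)%O -> ((m %/ l) * (n %/ m) = n %/ l)%N.
Proof. by rewrite !posdvd_leE => lm mn; rewrite mulnC muln_divA // divnK. Qed.

Section KernelLift.
Variables (R : pzRingType) (p q : nat -> nat).
Variable K : forall a, 'M[R]_(p a, q a).

Definition step_lift (l m : posdvd) := blowup (K (m %/ l)).

Hypothesis K1 : forall f, blowup (K 1) f = f.
Hypothesis KM : forall a b f, (0 < a)%N -> (0 < b)%N ->
  blowup (K (a * b)) f = blowup (K b) (blowup (K a) f).

Lemma step_lift_id l f : step_lift l l f = f.
Proof. by rewrite /step_lift divnn posdvd_nat_gt0. Qed.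

Lemma step_lift_comp l m n f : (l <= m)%O -> (m <= n)%O ->
  step_lift m n (step_lift l m f) = step_lift l n f.
Proof.
move=> lm mn; rewrite /step_lift -KM ?muln_posdvd_steps //;
  exact: divn_posdvd_gt0.
Qed.

End KernelLift.

(** * Elements determined by degree and entries *)

Lemma rinf_inj (R : realType) (x y : rinf R) :
  vdim x = vdim y -> entry (vval x) = entry (vval y) -> x = y.
Proof.
case: x y => [m m0 x] [n n0 y] /= mn; case: _ / mn n0 y => n0 y /entry_inj ->.
by rewrite (bool_irrelevance m0 n0).
Qed.

Lemma minf_inj (R : realType) (A B : minf R) :
  nrows A = nrows B -> ncols A = ncols B ->
  entry (mval A) = entry (mval B) -> A = B.
Proof.
case: A B => [m n m0 n0 A] [m' n' m0' n0' B] /= mm nn.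
case: _ / mm m0' B => m0'; case: _ / nn n0' => n0' B /entry_inj ->.
by rewrite (bool_irrelevance m0 m0') (bool_irrelevance n0 n0').
Qed.

Lemma mratio_inj (R : realType) (mu : rat) : injective (@mratio_val R mu).
Proof.
case=> A rA [B rB] /= AB; case: _ / AB rB => rB.
by rewrite (bool_irrelevance rA rB).
Qed.

(** * Vectors *)

Section VectorKernel.
Variables (R : realType) (K : forall a, 'cV[R]_a).

(** Both vector additions at once: the kernel of all-ones columns gives vbar
    and that of the columns E gives vhat. *)
Definition vkernel_add (x y : rinf R) : rinf R :=
  let t := lcmn (vdim x) (vdim y) in
  RInf (vdim_lcmn_gt0 x y)
    (castmx (mul_lcmn_divl _ _, erefl) (vval x *t K (t %/ vdim x)) +
     castmx (mul_lcmn_divr _ _, erefl) (vval y *t K (t %/ vdim y))).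

Definition vdeg (x : rinf R) : posdvd := @PosDvd (vdim x) (vdim_gt0 x).

Lemma vkernel_hyper_group :
    K 1 = 1 ->
    (forall a b, K (a * b) = K a *t K b) ->
  hyper_group vkernel_add (@vzero R).
Proof.
move=> K1 KM.
apply: (plonka_hyper_group (deg := vdeg) (coord := fun x => entry (vval x))
         (lift := step_lift K)) => [x y|l m|l f|l m n f lm mn|x y|x y|l|l|x].
- by move=> /(congr1 posdvd_nat); apply: rinf_inj.
- exact: blowupD.
- by apply: step_lift_id => g; apply: blowup1.
- apply: step_lift_comp => // a b g a0 b0.
  (* The width 1 has to be seen as the product 1 * 1. *)
  by rewrite KM (blowup_tens (n := 1) (q := 1)).
- exact: val_inj.
- rewrite entryD !entry_castmx !(entry_tens (n := 1) (q := 1)) //.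
    exact: divn_posdvd_gt0 (leUr (vdeg y) (vdeg x)).
  exact: divn_posdvd_gt0 (leUl (vdeg x) (vdeg y)).
- exact: val_inj.
- exact: entry0.
- exists (RInf (vdim_gt0 x) (- vval x)); split; [exact: val_inj|exact: entryN].
Qed.

End VectorKernel.

(** * Matrices of fixed ratio *)

Section RatioKernel.
Variables (R : realType) (mu : rat) (K : forall a, 'M[R]_a).

(** The kernel of identity matrices gives mbar_ratio and that of the matrices
    J gives mhat_ratio. *)
Definition mkernel_add (A B : mratio R mu) : mratio R mu :=
  let t := lcmn (level A) (level B) in
  MRatio (level_mx_ratio
    (castmx (level_rows_l A B, level_cols_l A B)
       (mval A *t K (t %/ level A)) +
     castmx (level_rows_r A B, level_cols_r A B)
       (mval B *t K (t %/ level B)))).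

Definition mdeg (A : mratio R mu) : posdvd := @PosDvd (level A) (level_gt0 A).

Lemma level_kernel_add A B : level (mkernel_add A B) = lcmn (level A) (level B).
Proof. by rewrite /level /= mulnK // (mu_y_gt0 (mratio_gt0 A)). Qed.

(** The zeros enter through a general family e because the square matrices
    and the matrices of an arbitrary ratio have differently built zeros. *)
Lemma mkernel_hyper_group (e : posdvd -> mratio R mu) :
    K 1 = 1 ->
    (forall a b, K (a * b) = K a *t K b) ->
    (forall n, level (e n) = n) -> (forall n, mval (e n) = 0) ->
  hyper_group mkernel_add e.
Proof.
move=> K1 KM level_e mval_e.
apply: (plonka_hyper_group (deg := mdeg) (coord := fun A => entry (mval A))
         (lift := step_lift K)) => [A B|l m|l f|l m n f lm mn|A B|A B|l|l|A].
- move=> /(congr1 posdvd_nat) /= lvAB AB; apply/mratio_inj/minf_inj => //.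
    by rewrite !nrows_level lvAB.
  by rewrite !ncols_level lvAB.
- exact: blowupD.
- by apply: step_lift_id => g; apply: blowup1.
- by apply: step_lift_comp => // a b g a0 b0; rewrite KM // blowup_tens.
- by apply: val_inj; apply: level_kernel_add.
- have tA := divn_posdvd_gt0 (leUl (mdeg A) (mdeg B)).
  have tB := divn_posdvd_gt0 (leUr (mdeg B) (mdeg A)).
  by rewrite entryD !entry_castmx !entry_tens.
- by apply: val_inj; apply: level_e.
- by rewrite mval_e entry0.
- have rA : has_ratio mu (MInf (nrows_gt0 A) (ncols_gt0 A) (- mval A)).
    exact: mratio_ratio A.
  exists (MRatio rA); split; [exact: val_inj|exact: entryN].
Qed.

End RatioKernel.

(** * The kernels are multiplicative *)

Section Kernels.
Variable R : realType.

Lemma Ecol_const n : Ecol R n = const_mx (Num.sqrt n%:R)^-1.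
Proof. by apply/matrixP=> i j; rewrite !mxE mulr1. Qed.

Lemma Emx_const m n :
  Emx R m n = const_mx ((Num.sqrt m%:R)^-1 * (Num.sqrt n%:R)^-1).
Proof.
by apply/matrixP=> i j; rewrite /Emx !Ecol_const !mxE big_ord1 !mxE.
Qed.

Lemma Jmx_const n : Jmx R n = const_mx n%:R^-1.
Proof. by apply/matrixP=> i j; rewrite !mxE big_ord1 !mxE !mulr1. Qed.

Lemma const_mx11 (a : R) : a = 1 -> const_mx a = 1 :> 'M_1.
Proof. by move=> ->; apply/matrixP=> i j; rewrite !mxE !ord1. Qed.

Lemma invsqrt_natM m n : (Num.sqrt (m * n)%:R)^-1 =
  (Num.sqrt m%:R)^-1 * (Num.sqrt n%:R)^-1 :> R.
Proof. by rewrite natrM sqrtrM ?ler0n // invfM. Qed.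

Lemma ones_tens m n : ones R (m * n) = ones R m *t ones R n.
Proof. by rewrite /ones tens_const_mx mulr1. Qed.

Lemma Ecol_tens m n : Ecol R (m * n) = Ecol R m *t Ecol R n.
Proof. by rewrite !Ecol_const tens_const_mx invsqrt_natM. Qed.

Lemma Jmx_tens m n : Jmx R (m * n) = Jmx R m *t Jmx R n.
Proof. by rewrite !Jmx_const tens_const_mx natrM invfM. Qed.

Lemma Emx_tens m n p q :
  Emx R (m * p) (n * q) = Emx R m n *t Emx R p q.
Proof. by rewrite !Emx_const tens_const_mx !invsqrt_natM mulrACA. Qed.

Lemma ones1 : ones R 1 = 1.
Proof. exact: const_mx11. Qed.

Lemma Ecol1 : Ecol R 1 = 1.
Proof. by rewrite Ecol_const const_mx11 // sqrtr1 invr1. Qed.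

Lemma Jmx1 : Jmx R 1 = 1.
Proof. by rewrite Jmx_const const_mx11 // invr1. Qed.

Lemma Emx1 : Emx R 1 1 = 1.
Proof. by rewrite Emx_const const_mx11 // sqrtr1 invr1 mulr1. Qed.

End Kernels.

(** * Matrices of all sizes *)

Section AllMatrices.
Variable R : realType.

Definition size_deg (A : minf R) : posdvd *p posdvd :=
  (@PosDvd (nrows A) (nrows_gt0 A), @PosDvd (ncols A) (ncols_gt0 A)).

(** Rows and columns are carried independently, so the degree lives in a
    product of two divisibility lattices and the kernel has two parameters. *)
Lemma mhat_hyper_group : hyper_group (@mhat R) (@mzero R).
Proof.
apply: (plonka_hyper_group (deg := size_deg) (coord := fun A => entry (mval A))
  (lift := fun l m => blowup (Emx R (m.1 %/ l.1) (m.2 %/ l.2))))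
  => [A B|l m|l f|l m n f|A B|A B|l|l|A].
- by case=> rAB cAB; apply: minf_inj.
- exact: blowupD.
- by rewrite !divnn !posdvd_nat_gt0 blowup1 // Emx1.
- move=> /andP[lm1 lm2] /andP[mn1 mn2].
  by rewrite -blowup_tens ?divn_posdvd_gt0 // -Emx_tens !muln_posdvd_steps.
- by congr pair; apply: val_inj.
- have /andP[/divn_posdvd_gt0 sA /divn_posdvd_gt0 tA] :
      (size_deg A <= size_deg A `|` size_deg B)%O by exact: leUl.
  have /andP[/divn_posdvd_gt0 sB /divn_posdvd_gt0 tB] :
      (size_deg B <= size_deg A `|` size_deg B)%O by exact: leUr.
  by rewrite entryD !entry_castmx !entry_tens.
- by case: l => m n; congr pair; apply: val_inj.
- exact: entry0.
- exists (MInf (nrows_gt0 A) (ncols_gt0 A) (- mval A)); split.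
    by congr pair; apply: val_inj.
  exact: entryN.
Qed.

End AllMatrices.

(** * The seven hyper groups *)

Theorem proposition3p8 (R : realType) :
  [/\ hyper_group (@vbar R) (@vzero R) /\ hyper_group (@vhat R) (@vzero R),
      hyper_group (@mbar_ratio R 1) (@mzero_square R) /\
      hyper_group (@mhat_ratio R 1) (@mzero_square R),
      forall (mu : rat) (mu0 : 0 < mu),
        hyper_group (@mbar_ratio R mu) (@mzero_ratio R mu mu0) /\
        hyper_group (@mhat_ratio R mu) (@mzero_ratio R mu mu0)
    & hyper_group (@mhat R) (@mzero R)].
Proof.
split=> [||mu mu0|]; last exact: mhat_hyper_group.
- split; first exact: vkernel_hyper_group (ones1 R) (ones_tens R).
  exact: vkernel_hyper_group (Ecol1 R) (Ecol_tens R).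
- have lv n : level (mzero_square R n) = n by rewrite /level divn1.
  split; last exact: mkernel_hyper_group (Jmx1 R) (Jmx_tens R) lv _.
  exact: (mkernel_hyper_group (K := fun a => 1%:M) _ (id_tens R) lv).
- have lv n : level (mzero_ratio R mu0 n) = n by rewrite /level mulnK ?mu_y_gt0.
  split; last exact: mkernel_hyper_group (Jmx1 R) (Jmx_tens R) lv _.
  exact: (mkernel_hyper_group (K := fun a => 1%:M) _ (id_tens R) lv).
Qed.
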